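(* Let $n\in\mathbb N$, $\overrightarrow{P}=(p_1,\dots,p_n)$ with $1\le p_1\le\cdots\le p_n<\infty$, and let $\chi$ be a kernel. For $w>0$ let $K_w(f)(\mathbf x)=\sum_{\mathbf k\in\mathbb Z^n}\chi(w\mathbf x-\mathbf k)\,w^n\int_{I_{\mathbf k,w}}f(\mathbf t)\,d\mathbf t$ with $I_{\mathbf k,w}=\prod_{j=1}^n[\frac{k_j}{w},\frac{k_j+1}{w}]$. Then for every continuous compactly supported $f:\mathbb R^n\to\mathbb R$, $$\lim_{w\to\infty}\|K_wf-f\|_{\overrightarrow P}=0.$$
   Context: A kernel is a function $\chi:\mathbb R^n\to\mathbb R$ with $\chi\in L^1(\mathbb R^n)$, bounded in a neighborhood of the origin, such that $\sum_{\mathbf k\in\mathbb Z^n}\chi(\mathbf u-\mathbf k)=1$ for every $\mathbf u\in\mathbb R^n$, and for a fixed $\alpha\ge0$ the absolute moment $m_\alpha(\chi):=\sup_{\mathbf u\in\mathbb R^n}\sum_{\mathbf k\in\mathbb Z^n}|\chi(\mathbf u-\mathbf k)|\,\|\mathbf u-\mathbf k\|_2^\alpha$ is finite. $\|f\|_{\overrightarrow P}=\Big(\int_{\mathbb R}\cdots\Big(\int_{\mathbb R}\Big(\int_{\mathbb R}|f(x_1,\dots,x_n)|^{p_1}dx_1\Big)^{p_2/p_1}dx_2\Big)^{p_3/p_2}\cdots dx_n\Big)^{1/p_n}$ is the mixed norm Lebesgue norm. *)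

(* Defs.v *)
From HB Require Import structures.
From mathcomp Require Import all_boot all_order all_algebra.
From mathcomp Require Import all_classical all_reals all_analysis.
Set Implicit Arguments. Unset Strict Implicit. Unset Printing Implicit Defensive.
Import Order.TTheory GRing.Theory Num.Theory.
Import numFieldNormedType.Exports.
Local Open Scope classical_set_scope.
Local Open Scope ring_scope.

Section Defs.
Variable R : realType.
Variable n : nat.

Definition upd (x : 'rV[R]_n) (j : nat) (t : R) : 'rV[R]_n :=
  \row_(i < n) (if val i == j then t else x 0 i).

Definition norm2 (x : 'rV[R]_n) : R := Num.sqrt (\sum_(i < n) x 0 i ^+ 2).

Definition zvec (k : 'I_n -> int) : 'rV[R]_n := \row_(i < n) (k i)%:~R.

Definition cube_sum (N : nat) (F : ('I_n -> int) -> R) : R :=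
  \sum_(k : {ffun 'I_n -> 'I_(N.*2.+1)}) F (fun i => (k i)%:Z - N%:Z).

Definition zsum (F : ('I_n -> int) -> R) : R :=
  lim ((fun N => cube_sum N F) @ \oo).

(* Mixed-norm operator: integrates out coordinates 0, ..., j-1 (x_1 innermost),
   coordinate j with exponent p j:
   G_0 = F,  G_{j+1}(x) = ( \int |G_j(x[j:=t])|^{p j} dt )^{1/p j}. *)
Fixpoint iter_norm (p : nat -> R) (j : nat) (F : 'rV[R]_n -> \bar R)
    : 'rV[R]_n -> \bar R :=
  match j with
  | 0 => F
  | j'.+1 => fun x =>
      poweR (\int[lebesgue_measure]_t
               poweR (iter_norm p j' F (upd x j' t)) (p j'))%E (p j')^-1
  end.

Definition mixed_norm (p : nat -> R) (f : 'rV[R]_n -> R) : \bar R :=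
  iter_norm p n (fun x => (`|f x|)%:E) 0.

Fixpoint iter_box_int (A : nat -> set R) (j : nat) (F : 'rV[R]_n -> \bar R)
    : 'rV[R]_n -> \bar R :=
  match j with
  | 0 => F
  | j'.+1 => fun x =>
      (\int[lebesgue_measure]_(t in A j') iter_box_int A j' F (upd x j' t))%E
  end.

Definition box_integral (A : nat -> set R) (f : 'rV[R]_n -> R) : R :=
  fine (iter_box_int A n (fun x => (f x)%:E) 0).

Definition kcoord (k : 'I_n -> int) (j : nat) : int :=
  match @insub nat (fun m => m < n)%N 'I_n j with Some i => k i | None => 0 end.

Definition Ibox (k : 'I_n -> int) (w : R) : nat -> set R :=
  fun j => `[(kcoord k j)%:~R / w, ((kcoord k j)%:~R + 1) / w]%classic.

Definition Kw (chi : 'rV[R]_n -> R) (w : R) (f : 'rV[R]_n -> R)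
    (x : 'rV[R]_n) : R :=
  zsum (fun k => chi (w *: x - zvec k) * (w ^+ n * box_integral (Ibox k w) f)).

Definition open_boxes : set (set 'rV[R]_n) :=
  [set B | exists a b : 'I_n -> R, B = [set x : 'rV[R]_n | forall i, a i < x 0 i < b i]].

Definition borelRn (B : set 'rV[R]_n) : Prop := <<s open_boxes >> B.

(* Lebesgue measure of a Borel set, computed as an iterated integral (Tonelli) *)
Definition borel_vol (B : set 'rV[R]_n) : \bar R :=
  iter_norm (fun _ => 1%R) n (fun x => (\1_B x)%:E) 0.

Definition nullRn (N : set 'rV[R]_n) : Prop :=
  exists B, borelRn B /\ N `<=` B /\ borel_vol B = 0%E.

Definition lebesgue_measurableRn (A : set 'rV[R]_n) : Prop :=
  exists B, borelRn B /\ nullRn ((A `\` B) `|` (B `\` A)).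

Definition lebesgue_measurable_funRn (g : 'rV[R]_n -> R) : Prop :=
  forall U : set R, measurable U -> lebesgue_measurableRn (g @^-1` U).

Definition L1Rn (g : 'rV[R]_n -> R) : Prop :=
  lebesgue_measurable_funRn g /\
  (iter_norm (fun _ => 1%R) n (fun x => (`|g x|)%:E) 0 < +oo)%E.

Definition is_kernel (alpha : R) (chi : 'rV[R]_n -> R) : Prop :=
  [/\ L1Rn chi,
      (exists delta M : R, 0 < delta /\
         forall u, norm2 u < delta -> `|chi u| <= M),
      (forall u : 'rV[R]_n,
         (fun N => cube_sum N (fun k => chi (u - zvec k))) @ \oo --> (1 : R)) &
      (exists M : R, forall (u : 'rV[R]_n) (N : nat),
         cube_sum N (fun k => `|chi (u - zvec k)| * norm2 (u - zvec k) `^ alpha)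
           <= M)].

End Defs.

(* Main.v *)
Require Import Defs.
From HB Require Import structures.
From mathcomp Require Import all_boot all_order all_algebra.
From mathcomp Require Import all_classical all_reals all_analysis.
From mathcomp Require Import measurable_realfun zify ring lra.
Import Order.TTheory GRing.Theory Num.Theory.
Import numFieldNormedType.Exports.
Local Open Scope classical_set_scope.
Local Open Scope ring_scope.

(** By the partition of unity, [K_w f - f] is bounded by the lattice sum
    [H = sum_k |chi (w x - k)| |c_k - f x|], with [c_k] the mean of [f] over the
    [k]-th box.  The change of variables [u = w x - k] turns the integral of [H] into
    that of [|chi u|] against a Riemann-type average of [|c_k - f ((u + k) / w)|],
    which is bounded and tends to [0] by uniform continuity; as [chi] is integrable,
    the [L^1] norm of [H] tends to [0].

    To pass from [L^1] to the mixed norm, one shows that all partial integrals of [H]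
    over [x_1, ..., x_j] are bounded uniformly in [w]: unfolding an integral over the
    line into an integral over [0, 1] of a sum over integer translates reduces this
    to the finiteness of the absolute moment of order [0].  Since
    [1 <= p_1 <= ... <= p_n], each integration step raises a bounded quantity to a
    power at least [1], so the mixed norm is dominated by a power of the [L^1] norm.

    As [chi] is only Lebesgue measurable, it is replaced by a Borel function off a
    Borel null set. *)

(** * One-dimensional integrals *)

(* Measurability is not needed: the integral of a nonnegative function is the supremum
   of the integrals of the simple functions below it. *)
Lemma le_integral_nomeas (d : measure_display) (T : measurableType d)
    (R : realType) (mu : {measure set T -> \bar R}) (D : set T)
    (f g : T -> \bar R) :
  (forall x, D x -> (f x <= g x)%E) ->
  (\int[mu]_(x in D) f x <= \int[mu]_(x in D) g x)%E.
Proof.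
move=> fg; rewrite /integral; apply: leeB.
  apply: ereal_sup_le => _ [h hf <-]; exists h => // x.
  apply: (le_trans (hf x)); rewrite !funeposE /patch; case: ifPn => // /set_mem Dx.
  by rewrite ge_max !le_max fg//= lexx orbT.
apply: ereal_sup_le => _ [h hf <-]; exists h => // x.
apply: (le_trans (hf x)); rewrite !funenegE /patch; case: ifPn => // /set_mem Dx.
by rewrite ge_max !le_max leeN2 fg//= lexx orbT.
Qed.

(** The exceptional null set is encoded by a function [z] of integral zero. Adding [+oo * z] to [g]
    leaves its integral unchanged and makes the comparison hold at every point. *)
Lemma ae_le_integral_nomeas (d : measure_display) (T : measurableType d)
    (R : realType) (mu : {measure set T -> \bar R}) (z f g : T -> \bar R) :
  measurable_fun setT z -> (forall x, (0 <= z x)%E) ->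
  measurable_fun setT g -> (forall x, (0 <= g x)%E) ->
  (\int[mu]_x z x = 0)%E ->
  (forall x, z x = 0%E -> (f x <= g x)%E) ->
  (\int[mu]_x f x <= \int[mu]_x g x)%E.
Proof.
move=> mz z0 mg g0 iz fg.
pose h x := (g x + +oo * z x)%E.
have h0 x : (0 <= h x)%E by rewrite adde_ge0// mule_ge0.
have -> : (\int[mu]_x g x = \int[mu]_x h x)%E.
  rewrite /h ge0_integralD//; last 2 first.
  - by move=> x _; rewrite mule_ge0.
  - by apply: emeasurable_funM => //; exact: measurable_cst.
  by rewrite ge0_integralZl// iz mule0 adde0.
apply: le_integral_nomeas => x _; rewrite /h.
have [zx|zx] := eqVneq (z x) 0%E.
  by rewrite zx mule0 adde0; exact: fg.
rewrite gt0_mulye; last by rewrite lt_def zx/= z0.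
by rewrite addey ?leey// gt_eqF// (lt_le_trans _ (g0 x))// ltNy0.
Qed.

Section one_dim.
Context {R : realType}.
Local Notation mu := (@lebesgue_measure R).

(** Lebesgue measure is [w] times its push-forward under [t |-> w * t - c]; by uniqueness this need
    only be checked on half-open intervals. *)
Lemma integral_affine (w c : R) (g : R -> \bar R) : 0 < w ->
  measurable_fun setT g -> (forall t, (0 <= g t)%E) ->
  (\int[mu]_t g (w * t - c)%R = (w^-1)%:E * \int[mu]_t g t)%E.
Proof.
move=> w0 mg g0.
pose phi : measurableTypeR R -> measurableTypeR R := fun t => w * t - c.
have mphi : measurable_fun setT phi.
  by apply: measurable_funB => //; exact: measurable_funM.
pose w' := NngNum (ltW w0).
pose push :=
  measure_function_pushforward__canonical__measure_function_Measure mu mphi.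
pose nu := mscale w' push.
have muE A : measurable A -> mu A = nu A.
  apply: lebesgue_measure_unique => _ [[a b]] _ <- /=.
  rewrite /nu /mscale/= /pushforward.
  have -> : phi @^-1` `]a, b]%classic = `](a + c) / w, (b + c) / w]%classic.
    apply/seteqP; split => t /=; rewrite !in_itv/= /phi ltrBrDr lerBlDr.
      by rewrite ltr_pdivrMr// ler_pdivlMr// ![t * w]mulrC.
    by rewrite ltr_pdivrMr// ler_pdivlMr// ![t * w]mulrC.
  rewrite !lebesgue_measure_itv/= !lte_fin ltr_pM2r ?invr_gt0// ltrD2r.
  case: ifPn => _; last by rewrite mule0.
  by rewrite -EFinB -EFinB -EFinM; congr EFin; field; rewrite gt_eqF.
have -> : (\int[mu]_t g t = \int[nu]_t g t)%E.
  by apply: eq_measure_integral => A mA _; exact: muE.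
rewrite ge0_integral_mscale// muleA -EFinM mulVf ?gt_eqF// mul1e.
by rewrite ge0_integral_pushforward//.
Qed.

Lemma integral_itv_shift (a : R) (K : nat) (g : R -> \bar R) :
  measurable_fun setT g -> (forall t, (0 <= g t)%E) ->
  (\int[mu]_(t in `[a, (a + K%:R)%R[) g t =
   \sum_(i < K) \int[mu]_(t in `[0%R, 1%R[) g (t + a + i%:R)%R)%E.
Proof.
move=> mg g0; elim: K => [|K IH].
  by rewrite addr0 set_itvco0 integral_set0 big_ord0.
rewrite big_ord_recr/= -IH.
rewrite (_ : `[a, (a + K.+1%:R)%R[%classic =
    `[a, (a + K%:R)%R[ `|` `[(a + K%:R)%R, (a + K.+1%:R)%R[); last first.
  by rewrite -itv_bndbnd_setU// bnd_simp ?lerDl// lerD2l ler_nat.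
rewrite ge0_integral_setU//; last 2 first.
  exact: measurable_funTS.
  apply/disj_setPS => x /=; rewrite !in_itv/= => -[/andP[_ h] /andP[h' _]].
  by move: h; rewrite ltNge h'.
congr (_ + _)%E.
rewrite integral_mkcond [RHS]integral_mkcond.
set J := `[(a + K%:R)%R, (a + K.+1%:R)%R[%classic.
(* A translation is the affine change of variables with slope 1. *)
transitivity (\int[mu]_t (g \_ J) (1 * t - (- (a + K%:R)))%R)%E.
  rewrite integral_affine//; first by rewrite invr1 mul1e.
    by apply/(measurable_restrictT g); [exact: measurable_itv|exact: measurable_funTS].
  by move=> t; apply: erestrict_ge0.
apply: eq_integral => t _; rewrite /patch mul1r opprK.
have -> : (t + (a + K%:R) \in J) = (t \in `[0, 1[%classic).
  rewrite /J !mem_setE.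
  by rewrite !in_itv/= lerDr -natr1 addrA; congr (_ && _); lra.
by rewrite addrA.
Qed.

(** The integral over [[-N, N[] is the integral over [[0, 1[] of the sum of [2N] translates, hence
    at most [C]; monotone convergence lets [N] tend to infinity. *)
Lemma integral_le_periodization (C : \bar R) (g : R -> \bar R) :
  measurable_fun setT g -> (forall t, (0 <= g t)%E) ->
  (forall t N, \sum_(i < N.*2) g (t - N%:R + i%:R)%R <= C)%E ->
  (\int[mu]_t g t <= C)%E.
Proof.
move=> mg g0 gC.
pose F (N : nat) : set R := `[- N%:R, - N%:R + (N.*2)%:R[%classic.
have FE N : F N = `[- N%:R, N%:R[%classic.
  by rewrite /F -addnn natrD addrA addNr add0r.
have UF : \bigcup_N F N = setT.
  apply/seteqP; split => // t _.
  exists (Num.bound `|t|).+1 => //=; rewrite FE/= in_itv/=.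
  have := archi_boundP (normr_ge0 t); rewrite ltr_norml.
  by rewrite -natr1 => /andP[h1 h2]; apply/andP; split; lra.
rewrite -UF.
have := @ge0_nondecreasing_set_cvg_integral _ (measurableTypeR R) _ F g mu.
move=> H; apply: (cvge_le _ (H _ _ _ _)).
- apply: nearW => N; rewrite integral_itv_shift// -ge0_integral_sum//; last first.
    move=> i; apply: measurable_funTS; apply: measurableT_comp => //.
    by do 2 apply: measurable_funD => //.
  apply: (@le_trans _ _ (\int[mu]_(t in `[0%R, 1%R[) cst C t)%E).
    by apply: le_integral_nomeas => t _; exact: gC.
  by rewrite integral_cst//= lebesgue_measure_itv/= lte_fin ltr01 oppr0 adde0 mule1.
- move=> m k mk; rewrite !FE subsetEset; apply: subset_itv; rewrite bnd_simp.
    by rewrite lerN2 ler_nat.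
  by rewrite ler_nat.
- by move=> i; exact: measurable_itv.
- by move=> i; exact: measurable_funTS.
- by move=> i x _.
Qed.
End one_dim.

(** * Iterated integrals over Borel functions *)

Notation borelV R n := (g_sigma_algebraType (@open_boxes R n)).

Section borel_rV.
Context {R : realType} {n : nat}.
Local Notation V := (borelV R n).

Lemma measurable_coord (i : 'I_n) :
  measurable_fun setT (fun x : V => x ord0 i : R).
Proof.
apply: (measurability _ (RGenOInfty.measurableE R)) => //.
move=> _ [_ [a ->] <-]; rewrite setTI.
(* The generating boxes are bounded, so a half-space is exhausted by boxes whose other sides are
   []-m, m[]. *)
rewrite (_ : _ @^-1` _ = \bigcup_m [set x : V | forall i' : 'I_n,
    (if i' == i then a else - m%:R) < x ord0 i' < m%:R]).
  apply: bigcup_measurable => m _; apply: sub_sigma_algebra.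
  by exists (fun i' => if i' == i then a else - m%:R), (fun=> m%:R).
apply/seteqP; split => x /=; rewrite in_itv/= andbT; last first.
  by move=> [m _ /(_ i)]; rewrite eqxx => /andP[].
move=> ax; pose M := \sum_(i' < n) `|x ord0 i'|.
exists (Num.bound M) => //= i'.
have M0 : 0 <= M by apply: sumr_ge0.
have := archi_boundP M0; set B := (Num.bound M)%:R => MB.
have : `|x ord0 i'| < B.
  apply: le_lt_trans MB; rewrite /M (bigD1 i')//= lerDl.
  exact: sumr_ge0.
rewrite ltr_norml => /andP[h1 h2].
by case: eqVneq => [E|_]; rewrite ?h1 h2 andbT// E.
Qed.

Lemma measurable_rV (d : measure_display) (X : measurableType d) (g : X -> V) :
  (forall i, measurable_fun setT (fun x => g x ord0 i : R)) ->
  measurable_fun setT g.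
Proof.
move=> mg; apply: (@measurability _ _ X V setT g (@open_boxes R n)) => //.
move=> _ [_ [a [b ->]] <-]; rewrite setTI.
rewrite (_ : _ @^-1` _ = \bigcap_(i in [set: 'I_n])
    ((fun x => g x ord0 i : R) @^-1` `]a i, b i[)).
  apply: fin_bigcap_measurable => [|i _]; first exact: finite_finset.
  by rewrite -[X in measurable X]setTI; exact: mg.
apply/seteqP; split => x /= h i; last by have := h i Logic.I; rewrite /= in_itv.
by move=> _; rewrite /= in_itv/= h.
Qed.

(** Joint measurability in the point and the new coordinate is what Tonelli's theorem requires in
    [measurable_iint]. *)
Lemma measurable_upd (j : nat) :
  measurable_fun setT (fun xt : V * measurableTypeR R => upd xt.1 j xt.2 : V).
Proof.
apply: measurable_rV => i; rewrite /upd.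
under eq_fun do rewrite mxE.
case: eqP => _; first exact: measurable_snd.
by apply: (measurableT_comp (measurable_coord i)); exact: measurable_fst.
Qed.

Lemma measurable_affine (w : R) (z : 'rV[R]_n) :
  measurable_fun setT (fun x : V => w *: (x : 'rV[R]_n) - z : V).
Proof.
apply: measurable_rV => i.
under eq_fun do rewrite !mxE.
apply: measurable_funB => //; apply: measurable_funM => //.
exact: measurable_coord.
Qed.

End borel_rV.

(** * Calculus of iterated integrals with all exponents equal to 1 *)

Section iterated_integral.
Context {R : realType} {n : nat}.
Local Notation V := (borelV R n).
Local Notation mu := (@lebesgue_measure R).
Implicit Types (F G : 'rV[R]_n -> \bar R) (x y z : 'rV[R]_n).
Local Open Scope ereal_scope.

(** For nonnegative [F] this is [iter_norm] with unit exponents, freed of the powers. The first [j]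
    coordinates of [x] are overwritten, so only the remaining ones matter. *)
Fixpoint iint (j : nat) F x : \bar R :=
  if j is j'.+1 then \int[mu]_t iint j' F (upd x j' t) else F x.

Lemma iint_ge0 j F x : (forall y, 0 <= F y) -> 0 <= iint j F x.
Proof.
move=> F0; elim: j x => [|j IH] x //=; exact: integral_ge0.
Qed.

Lemma iter_norm1E j F x : (forall y, 0 <= F y) ->
  iter_norm (fun=> 1%R) j F x = iint j F x.
Proof.
move=> F0; elim: j x => [|j IH] x //=.
rewrite invr1 poweRe1; last by apply: integral_ge0 => t _; exact: poweR_ge0.
by apply: eq_integral => t _; rewrite poweRe1 IH//; exact: iint_ge0.
Qed.

Lemma measurable_section j F x : measurable_fun setT (F : V -> \bar R) ->
  measurable_fun setT (fun t : measurableTypeR R => F (upd x j t)).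
Proof.
move=> mF; apply: (measurableT_comp mF).
apply: measurable_rV => i; rewrite /upd.
under eq_fun do rewrite mxE.
by case: eqP => _; [exact: measurable_id|exact: measurable_cst].
Qed.

Lemma measurable_iint j F : (forall y, 0 <= F y) ->
  measurable_fun setT (F : V -> \bar R) ->
  measurable_fun setT (iint j F : V -> \bar R).
Proof.
move=> F0 mF; elim: j => [//|j IH].
apply: (@measurable_fun_fubini_tonelli_F _ _ V (measurableTypeR R) R mu
  (fun xt => iint j F (upd xt.1 j xt.2))).
  by apply: (measurableT_comp IH); exact: measurable_upd.
by move=> xt; exact: iint_ge0.
Qed.

Lemma measurable_iint_section j F x : (forall y, 0 <= F y) ->
  measurable_fun setT (F : V -> \bar R) ->
  measurable_fun setT (fun t : measurableTypeR R => iint j F (upd x j t)).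
Proof. by move=> F0 mF; apply: measurable_section; exact: measurable_iint. Qed.

Lemma le_iint j F G x : (forall y, F y <= G y) -> iint j F x <= iint j G x.
Proof.
by move=> FG; elim: j x => [|j IH] x //=; apply: le_integral_nomeas => t _.
Qed.

Lemma eq_iint j F G x : F =1 G -> iint j F x = iint j G x.
Proof. by move=> /funext ->. Qed.

Lemma iint_coords j F x y :
  (forall i : 'I_n, (j <= i)%N -> x ord0 i = y ord0 i) ->
  iint j F x = iint j F y.
Proof.
elim: j x y => [|j IH] x y xy /=; first by congr F; apply/rowP => i; exact: xy.
apply: eq_integral => t _; apply: IH => i ji; rewrite !mxE; case: eqP => // ij.
by apply: xy; rewrite ltn_neqAle ji andbT; apply/eqP/nesym.
Qed.

Lemma iintn F x y : iint n F x = iint n F y.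
Proof. by apply: iint_coords => i; rewrite leqNgt ltn_ord. Qed.

Lemma iintD j F G x : (forall y, 0 <= F y) -> (forall y, 0 <= G y) ->
  measurable_fun setT (F : V -> \bar R) ->
  measurable_fun setT (G : V -> \bar R) ->
  iint j (fun y => F y + G y) x = iint j F x + iint j G x.
Proof.
move=> F0 G0 mF mG; elim: j x => [//|j IH] x /=.
under eq_integral do rewrite IH.
by rewrite ge0_integralD// => *; exact: iint_ge0 || exact: measurable_iint_section.
Qed.

Lemma iintZ j (k : R) F x : (0 <= k)%R -> (forall y, 0 <= F y) ->
  measurable_fun setT (F : V -> \bar R) ->
  iint j (fun y => k%:E * F y) x = k%:E * iint j F x.
Proof.
move=> k0 F0 mF; elim: j x => [//|j IH] x /=.
under eq_integral do rewrite IH.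
by rewrite ge0_integralZl_EFin// => *; exact: iint_ge0 || exact: measurable_iint_section.
Qed.

Lemma iint0 j x : iint j (fun=> 0) x = 0.
Proof. by elim: j x => [//|j IH] x /=; apply: integral0_eq => t _. Qed.

Lemma iint_sum (I : Type) (s : seq I) j (F : I -> 'rV[R]_n -> \bar R) x :
  (forall i y, 0 <= F i y) ->
  (forall i, measurable_fun setT (F i : V -> \bar R)) ->
  iint j (fun y => \sum_(i <- s) F i y) x = \sum_(i <- s) iint j (F i) x.
Proof.
move=> F0 mF; elim: s => [|i s IH].
  by rewrite big_nil -[RHS](iint0 j x); apply: eq_iint => y; rewrite big_nil.
rewrite big_cons -IH -iintD//.
- by apply: eq_iint => y; rewrite big_cons.
- by move=> y; exact: sume_ge0.
- exact: emeasurable_sum.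
Qed.

(** Each integrated coordinate contributes a factor [w^-1] by [integral_affine]; the coordinates not
    yet integrated are transformed in the base point. *)
Lemma iint_affine j (w : R) z F x : (0 < w)%R -> (j <= n)%N ->
  (forall y, 0 <= F y) -> measurable_fun setT (F : V -> \bar R) ->
  iint j (fun y => F (w *: y - z)%R) x =
  (w ^- j)%:E * iint j F (w *: x - z)%R.
Proof.
move=> w0 + F0 mF; elim: j x => [|j IH] x jn /=; first by rewrite invr1 mul1e.
pose zj := z ord0 (Ordinal jn).
transitivity (\int[mu]_t ((w ^- j)%:E *
    iint j F (upd (w *: x - z) j (w * t - zj)))).
  apply: eq_integral => t _; rewrite IH ?(ltnW jn)//.
  congr (_ * iint j F _); apply/rowP => i; rewrite !mxE.
  case: eqP => // ij; congr (_ - _)%R; rewrite /zj; congr (z _ _).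
  exact: val_inj.
rewrite (@integral_affine R w zj (fun s => (w ^- j)%:E *
    iint j F (upd (w *: x - z) j s)))//; last 2 first.
- by apply: emeasurable_funM => //; exact: measurable_iint_section.
- move=> t; rewrite mule_ge0//; last exact: iint_ge0.
  by rewrite lee_fin invr_ge0 exprn_ge0// ltW.
rewrite ge0_integralZl_EFin//; last 3 first.
- by move=> *; exact: iint_ge0.
- exact: measurable_iint_section.
- by rewrite invr_ge0 exprn_ge0// ltW.
by rewrite muleA -EFinM exprS invfM.
Qed.

Lemma iint_lim j (h : nat -> 'rV[R]_n -> \bar R) x :
  (forall N y, 0 <= h N y) ->
  (forall N, measurable_fun setT (h N : V -> \bar R)) ->
  (forall y, nondecreasing_seq (h^~ y)) ->
  iint j (fun y => limn (h^~ y)) x = limn (fun N => iint j (h N) x).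
Proof.
move=> h0 mh ndh; elim: j x => [//|j IH] x /=.
under eq_integral do rewrite IH.
rewrite monotone_convergence// => *.
- exact: measurable_iint_section.
- exact: iint_ge0.
- by move=> a b ab; apply: le_iint => y; exact: ndh.
Qed.

Lemma measurable_lim (h : nat -> 'rV[R]_n -> \bar R) :
  (forall N, measurable_fun setT (h N : V -> \bar R)) ->
  (forall y, nondecreasing_seq (h^~ y)) ->
  measurable_fun setT ((fun y => limn (h^~ y)) : V -> \bar R).
Proof.
move=> mh ndh; apply: (@emeasurable_fun_cvg _ V R setT h) => //.
by move=> y _; exact: ereal_nondecreasing_is_cvgn.
Qed.

Lemma iint_lim_le j (h : nat -> 'rV[R]_n -> \bar R) C x :
  (forall N y, 0 <= h N y) ->
  (forall N, measurable_fun setT (h N : V -> \bar R)) ->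
  (forall y, nondecreasing_seq (h^~ y)) ->
  (forall N, iint j (h N) x <= C) ->
  iint j (fun y => limn (h^~ y)) x <= C.
Proof.
move=> h0 mh ndh hC; rewrite iint_lim//; apply: lime_le; last exact: nearW.
apply: ereal_nondecreasing_is_cvgn => a b ab; apply: le_iint => y; exact: ndh.
Qed.

End iterated_integral.

(** * Mixed norms and iterated integrals *)

Section mixed_norm_bound.
Context {R : realType} {n : nat}.
Local Notation V := (borelV R n).
Local Notation mu := (@lebesgue_measure R).

Lemma powR_le_linear (C i r : R) : 0 <= i -> i <= C -> 1 <= r ->
  i `^ r <= C `^ (r - 1) * i.
Proof.
move=> i0 iC r1; have [->|i_neq0] := eqVneq i 0.
  by rewrite mulr0 powR0// gt_eqF// (lt_le_trans ltr01).
have {1}-> : r = (r - 1) + 1 by rewrite subrK.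
rewrite powRD; last by rewrite i_neq0 implybT.
rewrite powRr1// ler_wpM2r// ge0_ler_powR// ?subr_ge0// nnegrE//.
exact: le_trans iC.
Qed.

Lemma poweR_le_linear (C r D : R) (x i : \bar R) :
  (0 <= x)%E -> (0 <= i)%E -> 0 <= D -> 1 <= r ->
  (i <= C%:E)%E -> (x <= D%:E * i)%E ->
  (x `^ r <= (D `^ r * C `^ (r - 1))%:E * i)%E.
Proof.
case: i => [i| |] //; rewrite ?lee_fin => x0 i0 D0 r1 iC xDi.
have r0 : 0 <= r by exact: le_trans r1.
apply: (@le_trans _ _ ((D%:E * i%:E) `^ r)%E).
  by apply: gt0_ler_poweR => //; rewrite in_itv/= ?leey ?andbT// mule_ge0// lee_fin.
rewrite -EFinM poweR_EFin -EFinM lee_fin powRM// -mulrA ler_wpM2l ?powR_ge0//.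
exact: powR_le_linear.
Qed.

(** The exponent that undoes the outermost root in [iter_norm p j]. For [j = 0] no root has been
    taken, hence the value 1. *)
Definition prev_exp (p : nat -> R) (j : nat) : R := if j is i.+1 then p i else 1.

Lemma iter_norm_ge0 (p : nat -> R) j (F : 'rV[R]_n -> \bar R) x :
  (forall y, (0 <= F y)%E) -> (0 <= iter_norm p j F x)%E.
Proof. by move=> F0; case: j => [|j] //=; exact: poweR_ge0. Qed.

(* Since the exponents increase, each step raises a marginal bounded by [C] to a
   power at least 1, and [i ^ r <= C ^ (r - 1) * i] makes the bound linear again. *)
Lemma iter_norm_le_iint (p : nat -> R) (C : R) :
  (forall j, (j < n)%N -> 1 <= p j) ->
  (forall i j, (i <= j)%N -> (j < n)%N -> p i <= p j) ->
  forall j, (j <= n)%N -> exists2 D : R, 0 <= D &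
    forall F H Z : 'rV[R]_n -> \bar R,
    (forall y, (0 <= F y)%E) -> (forall y, (0 <= H y)%E) ->
    (forall y, (0 <= Z y)%E) ->
    measurable_fun setT (H : V -> \bar R) ->
    measurable_fun setT (Z : V -> \bar R) ->
    (forall i y, (i < n)%N -> (iint i H y <= C%:E)%E) ->
    (forall y, Z y = 0%E -> (F y <= H y)%E) ->
    forall y, iint j Z y = 0%E ->
    (iter_norm p j F y `^ prev_exp p j <= D%:E * iint j H y)%E.
Proof.
move=> p1 pmono; elim=> [_|j IH jn].
  exists 1 => // F H Z F0 H0 Z0 mH mZ HC FH y Zy /=.
  by rewrite poweRe1// mul1e; exact: FH.
have [D D0 HD] := IH (ltnW jn).
have q0 : 0 < prev_exp p j.
  case: j {IH HD} jn => //= j jn; apply: (lt_le_trans ltr01).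
  by apply: p1; exact: ltnW.
have qp : prev_exp p j <= p j.
  by case: j {IH HD q0} jn => [|j] jn /=; [exact: p1|exact: pmono].
have pj0 : 0 < p j by rewrite (lt_le_trans ltr01)// p1.
(* With this [r], the next integrand is the [r]-th power of the quantity bounded by the induction
   hypothesis, and [1 <= r] because the exponents increase. *)
pose r := p j / prev_exp p j.
have r1 : 1 <= r by rewrite ler_pdivlMr// mul1r.
exists (D `^ r * C `^ (r - 1)); first by rewrite mulr_ge0// powR_ge0.
move=> F H Z F0 H0 Z0 mH mZ HC FH y Zy /=.
rewrite -poweRrM mulVf ?gt_eqF// poweRe1; last first.
  by apply: integral_ge0 => t _; exact: poweR_ge0.
rewrite -ge0_integralZl_EFin//; last 3 first.
- by move=> t _; exact: iint_ge0.
- exact: measurable_iint_section.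
- by rewrite mulr_ge0// powR_ge0.
(* The integral over [t] of [iint j Z] vanishes, so the induction hypothesis is available for almost
   every [t], which suffices. *)
apply: (@ae_le_integral_nomeas _ _ _ mu (fun t => iint j Z (upd y j t))).
- exact: measurable_iint_section.
- by move=> t; exact: iint_ge0.
- by apply: emeasurable_funM => //; exact: measurable_iint_section.
- by move=> t; rewrite mule_ge0 ?iint_ge0// lee_fin mulr_ge0// powR_ge0.
- exact: Zy.
move=> t Zt.
have -> : p j = prev_exp p j * r by rewrite /r mulrC divfK// gt_eqF.
rewrite poweRrM; apply: poweR_le_linear => //.
- exact: poweR_ge0.
- exact: iint_ge0.
- exact: HC.
- exact: HD Zt.
Qed.

End mixed_norm_bound.

(** * Lattice sums *)

Section lattice.
Context {R : realType} {n : nat}.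
Local Notation V := (borelV R n).
Local Notation K := {ffun 'I_n -> int}.
Implicit Types (k : K) (s : seq K).

Definition cube (N : nat) : seq K :=
  [seq [ffun i => (k i)%:Z - N%:Z] | k : {ffun 'I_n -> 'I_(N.*2.+1)}].

Lemma cube_sumE N (F : ('I_n -> int) -> R) :
  cube_sum N F = \sum_(k <- cube N) F k.
Proof.
rewrite /cube_sum /cube big_map big_enum/=; apply: eq_bigr => k _.
by congr F; apply/funext => i; rewrite ffunE.
Qed.

Lemma mem_cube N k : (k \in cube N) = [forall i, `|k i| <= N%:Z].
Proof.
apply/mapP/forallP => [[h _ ->] i|h].
  by rewrite ffunE; move: (nat_of_ord (h i)) (ltn_ord (h i)) => m; lia.
exists [ffun i => inord (absz (k i + N%:Z))]; first by rewrite mem_enum.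
apply/ffunP => i; rewrite !ffunE inordK; last first.
  by have := h i; lia.
by have := h i; rewrite -[k _]/(k i); move: (k i) => m; lia.
Qed.

Lemma cube_uniq N : uniq (cube N).
Proof.
rewrite map_inj_uniq ?enum_uniq// => h h' /ffunP hh'; apply/ffunP => i.
by have := hh' i; rewrite !ffunE => /addIr [] /val_inj.
Qed.

Lemma cube_subset N M : (N <= M)%N -> {subset cube N <= cube M}.
Proof.
move=> NM k; rewrite !mem_cube => /forallP h; apply/forallP => i.
by have := h i; lia.
Qed.

Lemma le_sum_uniq (F : K -> \bar R) s s' : (forall k, (0 <= F k)%E) ->
  uniq s -> {subset s <= s'} -> (\sum_(k <- s) F k <= \sum_(k <- s') F k)%E.
Proof.
move=> F0 us ss'.
apply: (@le_trans _ _ (\sum_(k <- undup s') F k)%E); last first.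
  elim: s' {ss'} => [|k s' IH] //=; case: ifP => _; rewrite big_cons.
    by rewrite -[leLHS]add0e; apply: leeD.
  by rewrite big_cons; apply: leeD.
have -> : (\sum_(k <- s) F k = \sum_(k <- undup s' | k \in s) F k)%E.
  rewrite -[RHS]big_filter; apply: perm_big; apply: uniq_perm => //.
    by rewrite filter_uniq// undup_uniq.
  move=> k; rewrite mem_filter mem_undup; case ks: (k \in s) => //=.
  by rewrite ss'.
by rewrite big_mkcond/=; apply: lee_sum => k _; case: ifP.
Qed.

Lemma seq_sub_cube s : exists N, {subset s <= cube N}.
Proof.
elim: s => [|k s [N sN]]; first by exists 0%N.
exists (maxn N (\max_(i < n) (absz (k i)))) => k'; rewrite inE => /orP[/eqP ->|/sN].
  rewrite mem_cube; apply/forallP => i.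
  have /= := @leq_bigmax _ (fun i : 'I_n => absz (k i)) i.
  by move: (\max_(i < n) _)%N (k i) => X m; lia.
by apply: cube_subset; exact: leq_maxl.
Qed.

(** In coordinate [i] the admissible integers lie among the [L] consecutive ones starting at [a i],
    where [L] is the integer part of [2 * rho] plus 1. So [s] injects into a set of [L ^ n]
    functions. *)
Lemma lattice_count (v : 'rV[R]_n) (rho : R) s : 0 <= rho -> uniq s ->
  (forall k, k \in s -> forall i, `|v ord0 i + (k i)%:~R| <= rho) ->
  (size s)%:R <= (2 * rho + 1) ^+ n.
Proof.
move=> rho0 us hs.
pose L := (Num.truncn (2 * rho)).+1.
pose a (i : 'I_n) := Num.ceil (- v ord0 i - rho).
pose f k : {ffun 'I_n -> 'I_L} := [ffun i => inord (absz (k i - a i))].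
have hk k i : k \in s -> (a i <= k i) /\ (absz (k i - a i) < L)%N.
  move=> ks; have := hs k ks i; rewrite ler_norml => /andP[h1 h2].
  have ak : a i <= k i by rewrite ceil_le_int; lra.
  split => //.
  have e : (absz (k i - a i))%:R = (k i)%:~R - (a i)%:~R :> R.
    by rewrite -intrB natr_absz ger0_norm// subr_ge0.
  rewrite ltnS truncn_ge_nat ?mulr_ge0// e.
  have : - v ord0 i - rho <= (a i)%:~R by exact: ceil_ge.
  lra.
have uf : uniq (map f s).
  rewrite map_inj_in_uniq// => k k' ks k's /ffunP ff; apply/ffunP => i.
  have [h1 h2] := hk k i ks; have [h3 h4] := hk k' i k's.
  have := ff i; rewrite !ffunE => /(congr1 val); rewrite /= !inordK//; lia.
have := card_uniqP uf; rewrite size_map => <-.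
apply: (@le_trans _ _ (#|{ffun 'I_n -> 'I_L}|%:R)).
  by rewrite ler_nat max_card.
rewrite card_ffun !card_ord natrX lerXn2r ?nnegrE ?addr_ge0 ?mulr_ge0//.
rewrite /L -natr1 lerD2r truncn_le mulr_ge0//.
Qed.

Definition kupd k (o : 'I_n) (m : int) : K :=
  [ffun i => if i == o then m else k i].

(* Induction on [j]: integrating out one more coordinate is unfolded by
   [integral_le_periodization] into a lattice sum in that coordinate; [L] bounds the
   multiplicity with which the shifts in the integrated coordinates occur. *)
Lemma marginal_lattice_sum (psi : 'rV[R]_n -> \bar R) (M : R) :
  (forall y, (0 <= psi y)%E) -> measurable_fun setT (psi : V -> \bar R) ->
  (forall v N, (\sum_(k <- cube N) psi (v - zvec R k)%R <= M%:E)%E) ->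
  forall j (L : nat), (j <= n)%N -> forall v s, uniq s ->
  (forall k, k \in s -> forall i : 'I_n, (i < j)%N -> `|k i| <= L%:Z) ->
  (\sum_(k <- s) iint j psi (v - zvec R k)%R <= ((L.*2.+1)%:R ^+ j * M)%:E)%E.
Proof.
move=> psi0 mpsi hM; elim=> [|j IH] L jn v s us hs.
  rewrite expr0 mul1r; have [N sN] := seq_sub_cube s.
  by apply: le_trans (hM v N); apply: le_sum_uniq.
pose o := Ordinal jn.
(* The points of [s] are grouped by their coordinate [o], which takes at most [2L + 1] values. *)
pose c k : 'I_(L.*2.+1) := inord (absz (k o + L%:Z)).
rewrite big_seq (partition_big c predT)//=.
apply: (@le_trans _ _ (\sum_(l < L.*2.+1) ((L.*2.+1)%:R ^+ j * M)%:E)%E); last first.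
  by rewrite sumEFin sumr_const card_ord lee_fin exprS -mulrA mulr_natl.
apply: lee_sum => l _.
pose sl := [seq k <- s | c k == l].
have usl : uniq sl by rewrite filter_uniq.
rewrite -big_seq_cond -big_filter -/sl.
have slo k k' : k \in sl -> k' \in sl -> k o = k' o.
  rewrite !mem_filter => /andP[/eqP <- ks] /andP[/eqP/(congr1 val) + k's].
  have := hs _ ks o (ltnSn j); have := hs _ k's o (ltnSn j).
  rewrite /c /=; move: (k o) (k' o) => a b ha hb.
  by rewrite !inordK; lia.
rewrite /= -ge0_integral_sum//; last 2 first.
- by move=> k; exact: measurable_iint_section.
- by move=> k t _; exact: iint_ge0.
apply: integral_le_periodization.
- by apply: emeasurable_sum => k; exact: measurable_iint_section.
- by move=> t; apply: sume_ge0 => k _; exact: iint_ge0.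
move=> t N.
(* Translating coordinate [o] by [- N + i] amounts to replacing [k o] by [N - i]. The resulting
   points are distinct because [k o] is constant on [sl], and the induction hypothesis does not
   restrict coordinate [o]. *)
pose s' := [seq kupd k o (N%:Z - (i : 'I_(N.*2))%:Z) | i <- index_enum 'I_(N.*2), k <- sl].
have us' : uniq s'.
  apply: allpairs_uniq => //; first exact: index_enum_uniq.
  move=> [i k] [i' k'] /allpairsP[[a b]/= [_ bs [-> ->]]].
  move=> /allpairsP[[a' b']/= [_ b's [-> ->]]] /ffunP e.
  have := e o; rewrite !ffunE eqxx => aa'.
  have -> : a = a' by apply: val_inj => /=; lia.
  congr pair; apply/ffunP => i0; have [->|io] := eqVneq i0 o; first exact: slo.
  by have := e i0; rewrite !ffunE (negPf io).
have := IH L (ltnW jn) (upd v j t) s' us'; rewrite /s' big_allpairs_dep/= => H.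
apply: le_trans (H _).
  rewrite le_eqVlt; apply/orP; left; apply/eqP.
  apply: eq_bigr => i _; apply: eq_bigr => k _; congr (iint j psi _).
  apply/rowP => i0; rewrite !mxE ffunE -(inj_eq val_inj)/=.
  by case: eqP => // _; rewrite intrB opprB -!pmulrn addrA addrAC.
move=> k' /allpairsP[[a b]/= [_ bs ->]] i ij; rewrite ffunE.
have -> : (i == o) = false by apply/eqP => io; move: ij; rewrite io/= ltnn.
by apply: hs; [move: bs; rewrite mem_filter => /andP[]|exact: ltnW].
Qed.

End lattice.

(** * Borel modification; compactly supported functions *)

Section borel_modification.
Context {R : realType} {n : nat}.
Local Notation V := (borelV R n).

(** Each set where [|g|] exceeds a given rational agrees with a Borel set off a Borel null set. [Z]
    sums the indicators of these countably many null sets; where it vanishes, all superlevel sets of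
    [|g|] are traces of Borel sets. *)
Lemma borel_modification (g : 'rV[R]_n -> R) : lebesgue_measurable_funRn g ->
  exists Z : 'rV[R]_n -> \bar R,
  [/\ forall y, (0 <= Z y)%E, measurable_fun setT (Z : V -> \bar R),
      iint n Z 0 = 0%E &
      measurable_fun setT
        ((fun y => if Z y == 0%E then `|g y| else 0) : V -> R)].
Proof.
move=> mg.
(* An enumeration of the rationals; the default 0 at codes of no rational only repeats a value. *)
pose e (i : nat) : R := ratr (odflt 0 (unpickle i)).
have /choice[BN hBN] : forall i, exists BN : set V * set V,
    [/\ measurable BN.1, measurable BN.2,
        (forall y, ~ BN.2 y -> (e i < `|g y|) = (y \in BN.1)) &
        borel_vol (BN.2 : set 'rV[R]_n) = 0%E].
  move=> i; have mU : measurable [set r : R | e i < `|r|].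
    rewrite [X in measurable X](_ : _ = (fun r : R => `|r|) @^-1` `]e i, +oo[%classic); last first.
      by apply/seteqP; split => r /=; rewrite in_itv/= andbT.
    rewrite -[X in measurable X]setTI.
    by apply: (@normr_measurable R setT).
  have [B [mB [N [mN [BN N0]]]]] := mg _ mU.
  exists (B, N); split => //= y Ny.
  apply/idP/idP => [h|/set_mem h].
    by apply/mem_set; apply: contrapT => nB; apply: Ny; apply: BN; left.
  by apply: contrapT => h'; apply: Ny; apply: BN; right.
pose u i (y : 'rV[R]_n) : \bar R := (\1_((BN i).2 : set 'rV[R]_n) y)%:E.
have u0 i y : (0 <= u i y)%E by rewrite lee_fin.
have mu i : measurable_fun setT (u i : V -> \bar R).
  by apply/measurable_EFinP; apply: measurable_indic; have [] := hBN i.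
pose h m y := (\sum_(0 <= i < m) u i y)%E.
have ndh y : nondecreasing_seq (h^~ y).
  by apply: ereal_nondecreasing_series => i _ _.
have h0 m y : (0 <= h m y)%E by apply: sume_ge0.
have mh m : measurable_fun setT (h m : V -> \bar R) by apply: emeasurable_sum.
pose Z y := limn (h^~ y).
have hZ m y : (h m y <= Z y)%E.
  apply: lime_ge; first exact: ereal_nondecreasing_is_cvgn.
  by exists m => // k; exact: ndh.
have Z0 y : (0 <= Z y)%E by apply: le_trans (hZ 0%N y).
have mZ : measurable_fun setT (Z : V -> \bar R) by exact: measurable_lim.
have ZN y i : Z y = 0%E -> ~ (BN i).2 y.
  move=> Zy Ny; have := hZ i.+1 y; rewrite Zy /h big_nat_recr//= leNgt => /negP; apply.
  rewrite (@lt_le_trans _ _ (u i y))//.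
    by rewrite /u indicE mem_set// lte_fin.
  by rewrite -[leLHS]add0e leeD// h0.
exists Z; split => //.
  apply/eqP; rewrite eq_le iint_ge0// andbT.
  apply: iint_lim_le => // m; rewrite iint_sum// big1// => i _.
  have [_ _ _] := hBN i; rewrite /borel_vol iter_norm1E => [->//|y].
  by rewrite lee_fin.
apply: (measurability _ (RGenOInfty.measurableE R)) => //.
move=> _ [_ [a ->] <-]; rewrite setTI.
have [a0|a0] := ltP a 0.
  rewrite (_ : _ @^-1` _ = setT)//; apply/seteqP; split => // y _ /=.
  by rewrite in_itv/= andbT; case: ifP => // _; exact: lt_le_trans a0 _.
rewrite (_ : _ @^-1` _ = (Z : V -> \bar R) @^-1` [set 0%E] `&`
    \bigcup_(i in [set i | a < e i]) (BN i).1); last first.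
  apply/seteqP; split => y /=; rewrite in_itv/= andbT.
    case: ifPn => [/eqP Zy ag|_]; last by rewrite ltNge a0.
    split => //; have [q] := rat_in_itvoo ag; rewrite in_itv/= => /andP[aq qg].
    have eq : e (pickle q) = ratr q by rewrite /e pickleK.
    exists (pickle q); first by rewrite /= eq.
    have [_ _ H _] := hBN (pickle q); apply/set_mem; rewrite -H ?eq//.
    exact: ZN.
  move=> [Zy [i /= ai Bi]]; rewrite Zy eqxx; apply: (lt_trans ai).
  by have [_ _ H _] := hBN i; rewrite H ?mem_set//; exact: ZN.
apply: measurableI.
  by rewrite -[X in measurable X]setTI; exact: mZ.
by apply: bigcup_measurable => i _; have [] := hBN i.
Qed.

End borel_modification.

Section compact_support.
Context {R : realType} {n : nat}.
Variable f : 'rV[R]_n -> R.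
Hypotheses (cf : continuous f) (sf : compact (closure [set x | f x != 0])).

Let f0 x : ~ closure [set x | f x != 0] x -> f x = 0.
Proof.
by move=> nx; apply: contrapT => /eqP fx; apply: nx; exact: subset_closure.
Qed.

Lemma compact_supp_bounded : exists2 B : R, 0 < B &
  forall x, f x != 0 -> forall i, `|x ord0 i| <= B.
Proof.
have [B [Breal hB]] := compact_bounded sf.
exists (`|B| + 1); first by rewrite ltr_wpDl.
move=> x fx i.
have BB : B < `|B| + 1 by rewrite (le_lt_trans (ler_norm _))// ltrDl.
have Kx : closure [set x | f x != 0] x by exact: subset_closure.
apply: le_trans (hB _ BB x Kx).
by rewrite [leRHS]mx_normrE (le_bigmax _ (fun ij => `|x ij.1 ij.2|) (ord0, i)).
Qed.

Lemma compact_supp_fun_bounded : exists2 M : R, 0 <= M & forall x, `|f x| <= M.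
Proof.
have cfK : {within closure [set x | f x != 0], continuous f}.
  exact: continuous_subspaceT.
have [B [Breal hB]] := compact_bounded (continuous_compact cfK sf).
exists (`|B| + 1) => [|x]; first by rewrite addr_ge0.
have BB : B < `|B| + 1 by rewrite (le_lt_trans (ler_norm _))// ltrDl.
have [Kx|/f0 ->] := pselect (closure [set x | f x != 0] x).
  by apply: hB BB _ _; exists x.
by rewrite normr0 addr_ge0.
Qed.

(** Compactness makes [d] uniform for [x] in the closed support. If only [y] lies there the roles
    are exchanged; if neither does, both values are 0. *)
Lemma compact_supp_unif (e : R) : 0 < e -> exists2 d : R, 0 < d &
  forall x y : 'rV[R]_n, (forall i, `|x ord0 i - y ord0 i| < d) -> `|f x - f y| <= e.
Proof.
move=> e0.
pose P (d : R) (x : 'rV[R]_n) := forall y : 'rV[R]_n, (forall i, `|x ord0 i - y ord0 i| < d) ->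
  `|f x - f y| <= e.
have H : \forall d \near (0 : R)^'+, closure [set x | f x != 0] `<=` P d.
  have /compact_near_coveringP := sf; apply => x Kx.
  have /cvgrPdist_lt/(_ (e / 2)) := cf x.
  rewrite divr_gt0// => /(_ isT)/nbhs_ballP[r /= r0 hr].
  exists (ball x (r / 2), [set d | d < r / 2]) => /=.
    split; first by apply: nbhsx_ballx; rewrite divr_gt0.
    by apply: nbhs_right_lt; rewrite divr_gt0.
  move=> [x' d] /= [xx' dr] y x'y.
  have h1 : `|f x - f x'| < e / 2.
    by apply: hr; apply: le_ball xx'; rewrite ler_pdivrMr// ler_pMr// ler1n.
  have h2 : `|f x - f y| < e / 2.
    apply: hr; rewrite [r]splitr; apply: ball_triangle xx' _.
    split => [|i j]; first by rewrite divr_gt0.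
    by rewrite (ord1 i); exact: lt_trans (x'y j) dr.
  rewrite (_ : f x' - f y = (f x - f y) - (f x - f x')); last by ring.
  rewrite (le_trans (ler_normB _ _))// [e]splitr addrC.
  by apply: lerD; exact: ltW.
have [d [d0 hd]] := filter_ex (filterI (nbhs_right_gt (0 : R)) H).
exists d => // x y xy.
have [Kx|/f0 fx] := pselect (closure [set x | f x != 0] x); first exact: hd.
have [Ky|/f0 fy] := pselect (closure [set x | f x != 0] y).
  by rewrite distrC; apply: hd => // i; rewrite distrC.
by rewrite fx fy subrr normr0 ltW.
Qed.

End compact_support.

(** * Box means and absolute kernel sums *)

Section kernel_estimates.
Context {R : realType} {n : nat}.
Local Notation V := (borelV R n).
Local Notation mu := (@lebesgue_measure R).
Local Notation K := {ffun 'I_n -> int}.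

(** Each of the [n] integrations runs over an interval of length [w^-1] and multiplies both bounds
    by that length; the factor [w ^+ n] compensates. *)
Lemma box_mean_bounds (k : 'I_n -> int) (w a b : R) (f : 'rV[R]_n -> R) :
  0 < w ->
  (forall x : 'rV[R]_n,
    (forall i, (k i)%:~R / w <= x ord0 i <= ((k i)%:~R + 1) / w) ->
    a <= f x <= b) ->
  a <= w ^+ n * box_integral (Ibox k w) f <= b.
Proof.
move=> w0 hf.
have step j (y : 'rV[R]_n) : (j <= n)%N ->
    (forall i : 'I_n, (j <= i)%N ->
      (k i)%:~R / w <= y ord0 i <= ((k i)%:~R + 1) / w) ->
    ((a * w ^- j)%:E <= iter_box_int (Ibox k w) j (fun x => (f x)%:E) y
      <= (b * w ^- j)%:E)%E.
  elim: j y => [|j IH] y jn hy /=.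
    by rewrite !lee_fin invr1 !mulr1; apply: hf => i; exact: hy.
  have kE : kcoord k j = k (Ordinal jn) by rewrite /kcoord insubT.
  have cE c : ((c * w ^- j.+1)%:E =
      \int[mu]_(t in Ibox k w j) (cst (c * w ^- j)%:E) t)%E.
    rewrite integral_cst//; last exact: measurable_itv.
    rewrite /= /Ibox lebesgue_measure_itv/= lte_fin ltr_pM2r ?invr_gt0//.
    rewrite ltrDl ltr01 -EFinB -EFinM; congr EFin.
    by rewrite -mulrBl addrAC subrr add0r mul1r exprSr invfM mulrA mulrAC.
  have H t : Ibox k w j t -> ((a * w ^- j)%:E <=
      iter_box_int (Ibox k w) j (fun x => (f x)%:E) (upd y j t)
      <= (b * w ^- j)%:E)%E.
    rewrite /Ibox/= in_itv/= kE => ht; apply: IH; first exact: ltnW.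
    move=> i ji; rewrite mxE; case: eqP => ij.
      by have -> : i = Ordinal jn by exact: val_inj.
    by apply: hy; rewrite ltn_neqAle ji andbT; apply/eqP/nesym.
  rewrite !cE; apply/andP; split; apply: le_integral_nomeas => t /H /andP[] //.
have /= := step n 0 (leqnn n) _.
move=> /(_ _)/andP[|]; first by move=> i; rewrite leqNgt ltn_ord.
(* The two bounds exclude infinite values, which [fine] would send to 0. *)
rewrite /box_integral; case: iter_box_int => [r| |]//=; rewrite !lee_fin.
rewrite ler_pdivrMr ?exprn_gt0// ler_pdivlMr ?exprn_gt0// => h1 h2.
by rewrite mulrC h1 h2.
Qed.

Lemma le_norm2 (x : 'rV[R]_n) i : `|x ord0 i| <= norm2 x.
Proof.
rewrite /norm2 -sqrtr_sqr ler_sqrt; last by apply: sumr_ge0 => *; exact: sqr_ge0.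
by rewrite (bigD1 i)//= lerDl; apply: sumr_ge0 => *; exact: sqr_ge0.
Qed.

(* Where [norm2 (u - k) >= delta] the moment controls [chi]; the remaining
   boundedly many terms are controlled by the bound near the origin. *)
Lemma kernel_abs_sum_bounded (alpha : R) (chi : 'rV[R]_n -> R) :
  0 <= alpha -> is_kernel alpha chi ->
  exists2 M : R, 0 <= M &
    forall u N, \sum_(k <- cube N) `|chi (u - zvec R k)| <= M.
Proof.
move=> alpha0 [_ [delta [M1 [delta0 hM1]]] _ [M2 hM2]].
have da0 : 0 < delta `^ alpha by exact: powR_gt0.
exists (`|M2| / delta `^ alpha + `|M1| * (2 * delta + 1) ^+ n).
  rewrite addr_ge0// ?divr_ge0 ?(ltW da0)//.
  by rewrite mulr_ge0// exprn_ge0// addr_ge0// mulr_ge0// ltW.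
move=> u N.
pose far (k : K) := `|chi (u - zvec R k)| * norm2 (u - zvec R k) `^ alpha.
apply: (@le_trans _ _ (\sum_(k <- cube N) (far k / delta `^ alpha +
    if norm2 (u - zvec R k) < delta then `|M1| else 0))).
  apply: ler_sum => k _; case: ltP => h.
    apply: (le_trans (hM1 _ h)); apply: (le_trans (ler_norm _)).
    by rewrite lerDr mulr_ge0 ?invr_ge0 ?powR_ge0// mulr_ge0// powR_ge0.
  rewrite addr0 ler_pdivlMr// ler_wpM2l//.
  by apply: ge0_ler_powR => //; rewrite nnegrE ?ltW// (lt_le_trans delta0).
rewrite big_split/= -mulr_suml; apply: lerD.
  rewrite ler_pM2r ?invr_gt0//; apply: le_trans (ler_norm _).
  by apply: le_trans (hM2 u N); rewrite cube_sumE.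
rewrite -big_mkcond/= -big_filter big_const_seq count_predT.
rewrite iter_addr_0 -[leLHS]mulr_natr ler_wpM2l//.
apply: (@lattice_count R n (- u)); first exact: ltW.
  by rewrite filter_uniq ?cube_uniq.
move=> k; rewrite mem_filter => /andP[h _] i.
apply: le_trans (ltW h); apply: le_trans (le_norm2 _ i).
by rewrite !mxE -normrN opprD opprK.
Qed.

Definition cbox (r : R) : set 'rV[R]_n := [set x | forall i, `|x ord0 i| <= r].

Lemma measurable_cbox r : measurable (cbox r : set V).
Proof.
rewrite (_ : cbox r = \bigcap_(i in [set: 'I_n])
    ((fun x : V => x ord0 i : R) @^-1` `[- r, r])).
  apply: fin_bigcap_measurable => [|i _]; first exact: finite_finset.
  by rewrite -[X in measurable X]setTI; exact: measurable_coord.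
apply/seteqP; split => x /= h i.
  by move=> _; rewrite /= in_itv/= -ler_norml.
by rewrite ler_norml; have := h i Logic.I; rewrite /= in_itv.
Qed.

Lemma iint_cbox_le j r x : 0 <= r -> (j <= n)%N ->
  (iint j (fun y => (\1_(cbox r) y)%:E) x <= ((2 * r) ^+ j)%:E)%E.
Proof.
move=> r0 jn.
(* The induction keeps the indicator that the coordinates not yet integrated lie in [[-r, r]]; the
   next integration draws its range from it. *)
pose E (j : nat) (y : 'rV[R]_n) : R :=
  if [forall i : 'I_n, (j <= i)%N ==> (`|y ord0 i| <= r)] then 1 else 0.
apply: (@le_trans _ _ ((2 * r) ^+ j * E j x)%:E); last first.
  rewrite lee_fin -[leRHS]mulr1 ler_wpM2l ?exprn_ge0 ?mulr_ge0//.
  by rewrite /E; case: ifP.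
elim: j jn x => [|j IH] jn x.
  rewrite expr0 mul1r lee_fin indicE; case: (asboolP (cbox r x)) => [h|h].
    rewrite mem_set//= /E ifT//; apply/forallP => i; exact: h.
  by rewrite memNset// /E; case: ifP.
apply: (@le_trans _ _ (\int[mu]_(t in `[(- r)%R, r]) (cst ((2 * r) ^+ j * E j.+1 x)%:E) t)%E).
  rewrite [leRHS]integral_mkcond; apply: le_integral_nomeas => t _.
  apply: (le_trans (IH (ltnW jn) _)); rewrite /patch mem_setE in_itv/= -ler_norml.
  have -> : E j (upd x j t) = (if `|t| <= r then 1 else 0) * E j.+1 x.
    rewrite /E; case: ifP => [/forallP h|/forallPn[i]].
      have := h (Ordinal jn); rewrite /= leqnn mxE eqxx /= => ->.
      rewrite ifT ?mulr1//; apply/forallP => i; apply/implyP => ji.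
      by have := h i; rewrite (ltnW ji)/= mxE gtn_eqF.
    rewrite negb_imply mxE => /andP[ji].
    case: eqP => [ij|ij] h; first by rewrite (negPf h) mul0r.
    rewrite [X in _ = _ * X]ifF ?mulr0//; apply/forallPn; exists i.
    by rewrite negb_imply h andbT ltn_neqAle ji andbT; apply/eqP/nesym.
  by case: ifP => _; rewrite ?mul1r// mul0r mulr0.
rewrite integral_cst//= lebesgue_measure_itv/= lte_fin.
have [r1|r1] := ltP (- r) r.
  by rewrite -EFinB -EFinM lee_fin exprS opprK le_eqVlt; apply/orP; left; apply/eqP; ring.
rewrite mule0 lee_fin mulr_ge0 ?exprn_ge0 ?mulr_ge0//.
by rewrite /E; case: ifP.
Qed.

End kernel_estimates.

(** * The majorant *)

Section majorant.
Context {R : realType} {n : nat}.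
Local Notation V := (borelV R n).
Local Notation K := {ffun 'I_n -> int}.
Variables (phi : 'rV[R]_n -> R) (M B w : R).
Hypotheses (phi0 : forall u, 0 <= phi u)
  (mphi : measurable_fun setT (phi : V -> R))
  (hM : forall u N, \sum_(k <- cube N) phi (u - zvec R k) <= M)
  (B0 : 0 <= B) (w1 : 1 <= w).

Let w0 : 0 < w. Proof. exact: lt_le_trans w1. Qed.
Let Phi u : \bar R := (phi u)%:E.
Let Phi0 u : (0 <= Phi u)%E. Proof. by rewrite lee_fin. Qed.
Let mPhi : measurable_fun setT (Phi : V -> \bar R).
Proof. exact/measurable_EFinP. Qed.
Let M0 : 0 <= M.
Proof. by apply: le_trans (hM 0 0); exact: sumr_ge0. Qed.

(** Scaled by [w], the box of index [k] is [k + [0, 1]^n]. If it meets [cbox B] then every [|k i|]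
    is at most [B * w + 1], the 1 being the side of the scaled box. *)
Definition near_lattice (k : K) : bool := zvec R k \in cbox (B * w + 1).

(** The bracket is positive whenever the box mean of index [k] or the value at [x] of a function
    supported in [cbox B] can be nonzero; [phi] stands for [|chi|] times a bound on their
    difference. *)
Definition maj_sum (N : nat) (x : 'rV[R]_n) : \bar R :=
  (\sum_(k <- cube N) (phi (w *: x - zvec R k)%R *
    ((near_lattice k)%:R + \1_(cbox B) x))%:E)%E.

Definition maj (x : 'rV[R]_n) : \bar R := limn (maj_sum ^~ x).

Let a1 (k : K) x : \bar R := (phi (w *: x - zvec R k) * (near_lattice k)%:R)%:E.
Let a2 (k : K) x : \bar R := (phi (w *: x - zvec R k) * \1_(cbox B) x)%:E.

Let a1_ge0 k x : (0 <= a1 k x)%E. Proof. by rewrite lee_fin mulr_ge0. Qed.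
Let a2_ge0 k x : (0 <= a2 k x)%E. Proof. by rewrite lee_fin mulr_ge0. Qed.

Let mphik k : measurable_fun setT
  ((fun x => phi (w *: x - zvec R k)) : V -> R).
Proof. exact: (measurableT_comp mphi (measurable_affine w (zvec R k))). Qed.

Let ma1 k : measurable_fun setT (a1 k : V -> \bar R).
Proof. by apply/measurable_EFinP; apply: measurable_funM. Qed.

Let ma2 k : measurable_fun setT (a2 k : V -> \bar R).
Proof.
apply/measurable_EFinP; apply: measurable_funM => //.
by apply: measurable_indic; exact: measurable_cbox.
Qed.

Let maj_sumE N x :
  maj_sum N x = (\sum_(k <- cube N) a1 k x + \sum_(k <- cube N) a2 k x)%E.
Proof.
by rewrite -big_split/=; apply: eq_bigr => k _; rewrite -EFinD -mulrDr.
Qed.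

Let sa1_ge0 N x : (0 <= \sum_(k <- cube N) a1 k x)%E.
Proof. exact: sume_ge0. Qed.
Let sa2_ge0 N x : (0 <= \sum_(k <- cube N) a2 k x)%E.
Proof. exact: sume_ge0. Qed.
Let msa1 N : measurable_fun setT
  ((fun x => \sum_(k <- cube N) a1 k x)%E : V -> \bar R).
Proof. exact: emeasurable_sum. Qed.
Let msa2 N : measurable_fun setT
  ((fun x => \sum_(k <- cube N) a2 k x)%E : V -> \bar R).
Proof. exact: emeasurable_sum. Qed.

Lemma maj_sum_ge0 N x : (0 <= maj_sum N x)%E.
Proof. by rewrite maj_sumE adde_ge0. Qed.

Lemma measurable_maj_sum N : measurable_fun setT (maj_sum N : V -> \bar R).
Proof.
rewrite (_ : maj_sum N = fun x => (\sum_(k <- cube N) a1 k x + \sum_(k <- cube N) a2 k x)%E).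
  exact: emeasurable_funD.
exact/funext/maj_sumE.
Qed.

Lemma nondecreasing_maj_sum x : nondecreasing_seq (maj_sum ^~ x).
Proof.
move=> N N' NN'; apply: le_sum_uniq.
- by move=> k; rewrite lee_fin mulr_ge0// addr_ge0.
- exact: cube_uniq.
- exact: cube_subset.
Qed.

Lemma maj_sum_le_maj N x : (maj_sum N x <= maj x)%E.
Proof.
apply: lime_ge; first exact/ereal_nondecreasing_is_cvgn/nondecreasing_maj_sum.
by exists N => // k; exact: nondecreasing_maj_sum.
Qed.

Lemma maj_ge0 x : (0 <= maj x)%E.
Proof. by apply: le_trans (maj_sum_le_maj 0 x); exact: maj_sum_ge0. Qed.

Lemma measurable_maj : measurable_fun setT (maj : V -> \bar R).
Proof.
by apply: measurable_lim; [exact: measurable_maj_sum|exact: nondecreasing_maj_sum].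
Qed.

Let iint_a1 N j y : (j <= n)%N ->
  (iint j (fun x => \sum_(k <- cube N) a1 k x) y =
  (w ^- j)%:E * \sum_(k <- [seq k <- cube N | near_lattice k])
     iint j Phi (w *: y - zvec R k)%R)%E.
Proof.
move=> jn; rewrite iint_sum// big_filter [in RHS]big_mkcond/= ge0_sume_distrr; last first.
  by move=> k _; case: ifP => // _; exact: iint_ge0.
apply: eq_bigr => k _; case: ifPn => h.
  rewrite -iint_affine//; apply: eq_iint => x.
  by rewrite /a1 h mulr1.
rewrite mule0; transitivity (iint j (fun=> 0%E) y); last exact: iint0.
apply: eq_iint => x.
by rewrite /a1 (negPf h) mulr0.
Qed.

(** Per coordinate, [2 * (B * w + 1) + 1] lattice points divided by [w] give [2 * B + 3 / w], at
    most [2 * B + 3] since [1 <= w]. *)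
Let A := (2 * B + 3) ^+ n.

Let pow_le_A j : (j <= n)%N -> (2 * B + 3) ^+ j <= A.
Proof. by move=> jn; apply: ler_weXn2l => //; move: B0; lra. Qed.

(** In the first part of the majorant the scaling factor [w ^- j] absorbs the multiplicity from
    [marginal_lattice_sum]. In the second the lattice sum is at most [M] pointwise, and only the
    size of [cbox B] remains. Neither bound depends on [w]. *)
Lemma iint_maj_marginal j y : (j <= n)%N -> (iint j maj y <= (2 * M * A)%:E)%E.
Proof.
move=> jn; apply: iint_lim_le.
- exact: maj_sum_ge0.
- exact: measurable_maj_sum.
- exact: nondecreasing_maj_sum.
move=> N; rewrite (eq_iint _ _ _ _ (maj_sumE N)) iintD//.
rewrite (_ : 2 * M * A = A * M + A * M); last by ring.
rewrite EFinD; apply: leeD.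
  rewrite iint_a1//.
  pose L := Num.truncn (B * w + 1).
  have Bw0 : 0 <= B * w + 1 by rewrite addr_ge0// mulr_ge0// ltW.
  have LB : L%:R <= B * w + 1 by rewrite truncn_le.
  have wj0 : 0 <= w ^- j by rewrite invr_ge0 exprn_ge0// ltW.
  apply: (@le_trans _ _ ((w ^- j)%:E * ((L.*2.+1)%:R ^+ j * M)%:E)%E).
    apply: lee_wpmul2l; first by rewrite lee_fin.
    apply: marginal_lattice_sum => //.
    - by move=> v N'; rewrite sumEFin lee_fin.
    - by rewrite filter_uniq ?cube_uniq.
    move=> k; rewrite mem_filter => /andP[/set_mem /= kB _] i _.
    have := kB i; rewrite mxE -intr_norm.
    rewrite -[`|k i|]gez0_abs// -pmulrn => h.
    by rewrite lez_nat truncn_ge_nat.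
  rewrite -EFinM lee_fin mulrA ler_wpM2r// (le_trans _ (pow_le_A _ jn))//.
  rewrite mulrC -expr_div_n lerXn2r ?nnegrE ?divr_ge0 ?(ltW w0)//.
    by rewrite addr_ge0// mulr_ge0.
  rewrite ler_pdivrMr// -natr1 -mul2n natrM.
  have : 0 <= w - 1 by rewrite subr_ge0.
  lra.
apply: (@le_trans _ _ (iint j (fun x => (M%:E * (\1_(cbox B) x)%:E)) y)%E).
  apply: le_iint => x; rewrite /a2 sumEFin -mulr_suml -EFinM lee_fin.
  by rewrite ler_wpM2r.
rewrite iintZ//; last first.
  by apply/measurable_EFinP; apply: measurable_indic; exact: measurable_cbox.
rewrite mulrC EFinM; apply: lee_wpmul2l; first by rewrite lee_fin.
apply: (le_trans (iint_cbox_le _ _ _ B0 jn)); rewrite lee_fin.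
apply: le_trans (pow_le_A _ jn); rewrite lerXn2r ?nnegrE ?addr_ge0 ?mulr_ge0//.
by rewrite lerDl.
Qed.

(** This bound is linear in the integral of [phi], which will be made small. Both parts reduce to
    counting lattice points: the near ones in the first, and in the second, for fixed [u = w x - k],
    those [k] with [(u + k) / w] in [cbox B]. *)
Lemma iint_maj_total y : (iint n maj y <= (2 * A)%:E * iint n Phi 0)%E.
Proof.
have I0 : (0 <= iint n Phi 0)%E by exact: iint_ge0.
have wn0 : 0 < w ^- n by rewrite invr_gt0 exprn_gt0.
have wn0' : (0 <= (w ^- n)%:E)%E by rewrite lee_fin ltW.
have count_le (c : R) (s : seq K) : 0 <= c -> 2 * c + 1 <= (2 * B + 3) * w ->
    (size s)%:R <= (2 * c + 1) ^+ n -> w ^- n * (size s)%:R <= A.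
  move=> c0 cw; rewrite [w ^- n * _]mulrC ler_pdivrMr ?exprn_gt0//.
  move=> /le_trans; apply; rewrite -exprMn lerXn2r ?nnegrE//.
    by rewrite addr_ge0// mulr_ge0.
  by rewrite mulr_ge0 ?addr_ge0 ?mulr_ge0// ltW.
apply: iint_lim_le.
- exact: maj_sum_ge0.
- exact: measurable_maj_sum.
- exact: nondecreasing_maj_sum.
move=> N; rewrite (eq_iint _ _ _ _ (maj_sumE N)) iintD//.
rewrite (_ : 2 * A = A + A); last by ring.
rewrite EFinD ge0_muleDl; last 2 first.
- by rewrite lee_fin exprn_ge0// addr_ge0// mulr_ge0.
- by rewrite lee_fin exprn_ge0// addr_ge0// mulr_ge0.
apply: leeD.
  rewrite iint_a1//.
  under eq_bigr do rewrite (iintn _ _ 0) -[iint n Phi 0]mul1e.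
  rewrite -ge0_sume_distrl// sumEFin muleA -EFinM; apply: lee_wpmul2r => //.
  rewrite big_const_seq count_predT iter_addr_0.
  rewrite lee_fin; apply: (count_le (B * w + 1)).
  - by rewrite addr_ge0// mulr_ge0// ltW.
  - by move: w1; lra.
  - apply: (@lattice_count R n 0).
    + by rewrite addr_ge0// mulr_ge0// ltW.
    + by rewrite filter_uniq ?cube_uniq.
    move=> k; rewrite mem_filter => /andP[/set_mem /= kB _] i.
    by have := kB i; rewrite !mxE add0r.
(* The term [a2 k] in the variable [u = w x - k], with [x = (u + k) / w] written in the form handled
   by [measurable_affine]. *)
pose b (k : K) u : \bar R := (phi u * \1_(cbox B) (w^-1 *: u - (- (w^-1 *: zvec R k))))%:E.
have b0 k u : (0 <= b k u)%E by rewrite lee_fin mulr_ge0.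
have mb k : measurable_fun setT (b k : V -> \bar R).
  apply/measurable_EFinP; apply: measurable_funM => //.
  have m1 : measurable_fun setT (\1_(cbox B) : V -> R).
    by apply: measurable_indic; exact: measurable_cbox.
  exact: (measurableT_comp m1 (measurable_affine w^-1 (- (w^-1 *: zvec R k)))).
have a2E k x : a2 k x = b k (w *: x - zvec R k).
  rewrite /a2 /b opprK -scalerDr subrK scalerA mulVf ?gt_eqF// scale1r//.
rewrite iint_sum//.
under eq_bigr => k _.
  rewrite (eq_iint _ _ _ _ (a2E k)) iint_affine// (iintn _ _ 0).
  over.
rewrite -ge0_sume_distrr; last by move=> k _; exact: iint_ge0.
rewrite -iint_sum// -iintZ ?(ltW wn0)//; last 2 first.
- by move=> u; exact: sume_ge0.
- exact: emeasurable_sum.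
rewrite -iintZ//; last by rewrite exprn_ge0// addr_ge0// mulr_ge0.
apply: le_iint => u.
rewrite /b sumEFin -mulr_sumr -EFinM -EFinM lee_fin mulrCA mulrC ler_wpM2r//.
rewrite (eq_bigr (fun k : K =>
    if (w^-1 *: u - - (w^-1 *: zvec R k) \in cbox B) then 1 else 0)); last first.
  by move=> k _; rewrite indicE; case: ifP.
rewrite -big_mkcond/= -big_filter big_const_seq count_predT iter_addr_0.
apply: (count_le (B * w)).
- by rewrite mulr_ge0// ltW.
- by move: w1; lra.
apply: (@lattice_count R n u).
- by rewrite mulr_ge0// ltW.
- by rewrite filter_uniq ?cube_uniq.
move=> k; rewrite mem_filter => /andP[/set_mem /= kB _] i.
have := kB i; rewrite !mxE opprK -mulrDr normrM gtr0_norm ?invr_gt0//.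
by rewrite mulrC ler_pdivrMr.
Qed.

End majorant.

(** * Convergence *)

Section convergence.
Context {R : realType} {n : nat}.
Local Notation V := (borelV R n).
Local Notation K := {ffun 'I_n -> int}.

(** By monotone convergence some cube carries more than [S - e] of the total mass [S]; outside any
    larger cube at most [e] is left. *)
Lemma iint_tail (psi : 'rV[R]_n -> R) (e : R) :
  (forall u, 0 <= psi u) -> measurable_fun setT (psi : V -> R) ->
  (iint n (fun u => (psi u)%:E) 0 < +oo)%E -> 0 < e ->
  exists r0 : R, forall r, r0 <= r ->
  (iint n (fun u => (psi u * \1_(~` cbox r) u)%:E) 0 <= e%:E)%E.
Proof.
move=> psi0 mpsi Ipsi e0.
have Psi0 u : (0 <= (psi u)%:E)%E by rewrite lee_fin.
pose h (N : nat) u : \bar R := (psi u * \1_(cbox N%:R) u)%:E.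
have h0 N u : (0 <= h N u)%E by rewrite lee_fin mulr_ge0.
have mh N : measurable_fun setT (h N : V -> \bar R).
  apply/measurable_EFinP; apply: measurable_funM => //.
  by apply: measurable_indic; exact: measurable_cbox.
have ndh u : nondecreasing_seq (h^~ u).
  move=> N N' NN'; rewrite lee_fin ler_wpM2l// !indicE ler_nat.
  case: (boolP (u \in cbox N%:R)) => //= /set_mem uN; rewrite mem_set//= => i.
  by apply: le_trans (uN i) _; rewrite ler_nat.
have hlim u : limn (h^~ u) = (psi u)%:E.
  apply: cvg_lim => //; apply: cvg_near_cst.
  pose s := \sum_(i < n) `|u ord0 i|.
  have s0 : 0 <= s by exact: sumr_ge0.
  exists (Num.bound s) => // N /= sN; rewrite /h indicE mem_set ?mulr1// => i.
  apply: (@le_trans _ _ s); first by rewrite /s (bigD1 i)//= lerDl; exact: sumr_ge0.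
  by apply: (le_trans (ltW (archi_boundP s0))); rewrite ler_nat.
set S := iint n _ 0 in Ipsi.
have Sfin : S \is a fin_num by rewrite ge0_fin_numE//; exact: iint_ge0.
have [N hN] : exists N, (S - e%:E < iint n (h N) 0)%E.
  apply: contrapT => /forallNP H.
  suff : (S <= S - e%:E)%E.
    by rewrite -(fineK Sfin) -EFinB lee_fin lerBrDr gerDl leNgt e0.
  rewrite {1}/S (_ : (fun u => (psi u)%:E) = fun u => limn (h^~ u)); last first.
    by apply/funext => u; rewrite hlim.
  by apply: iint_lim_le => // N; rewrite leNgt; apply/negP; exact: H.
exists N%:R => r Nr.
pose t u : \bar R := (psi u * \1_(~` cbox r) u)%:E.
have t0 u : (0 <= t u)%E by rewrite lee_fin mulr_ge0.
have mt : measurable_fun setT (t : V -> \bar R).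
  apply/measurable_EFinP; apply: measurable_funM => //.
  apply: measurable_indic; apply: measurableC; exact: measurable_cbox.
have : (iint n t 0 + iint n (h N) 0 <= S)%E.
  rewrite -iintD//; apply: le_iint => u; rewrite -EFinD lee_fin -mulrDr.
  rewrite -[leRHS]mulr1 ler_wpM2l// !indicE in_setC.
  case: (boolP (u \in cbox r)) => /=; first by rewrite add0r lern1 leq_b1.
  move=> ur; rewrite [u \in cbox N%:R]memNset ?addr0//= => uN.
  by move/negP: ur; apply; apply/mem_set => i; apply: le_trans (uN i) _.
move: hN; have : (0 <= iint n (h N) 0)%E by exact: iint_ge0.
have : (0 <= iint n t 0)%E by exact: iint_ge0.
rewrite -/t -(fineK Sfin) -EFinB.
case: (iint n t 0) => [a| |]//; case: (iint n (h N) 0) => [b| |]//.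
by rewrite lte_fin -EFinD !lee_fin => _ _ ? ?; lra.
Qed.

(** * Comparison of box means with point values *)

Section sampling.
Variables (f : 'rV[R]_n -> R) (B Mf eps delta w : R).
Hypotheses (hB : forall x, f x != 0 -> forall i, `|x ord0 i| <= B)
  (hMf : forall x, `|f x| <= Mf)
  (huc : forall x y : 'rV[R]_n,
    (forall i, `|x ord0 i - y ord0 i| < delta) -> `|f x - f y| <= eps)
  (eps0 : 0 <= eps) (w1 : 1 <= w).

Let w0 : 0 < w. Proof. exact: lt_le_trans w1. Qed.
Let Mf0 : 0 <= Mf. Proof. exact: le_trans (hMf 0). Qed.

Definition box_mean (k : 'I_n -> int) : R := w ^+ n * box_integral (Ibox k w) f.

Let in_box (k y : R) : (k / w <= y <= (k + 1) / w) = (k <= w * y <= k + 1).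
Proof. by rewrite ler_pdivrMr// ler_pdivlMr// [y * w]mulrC. Qed.

Lemma box_mean_eq0 (k : K) : ~~ near_lattice B w k -> box_mean k = 0.
Proof.
move=> kB; suff /andP[h1 h2] : 0 <= box_mean k <= 0 by apply/eqP; rewrite eq_le h1 h2.
apply: box_mean_bounds => // x hx.
have [->|fx] := eqVneq (f x) 0; first by rewrite lexx.
exfalso; move/negP: kB; apply; apply/mem_set => i; rewrite mxE.
have := hx i; rewrite in_box => /andP[h1 h2].
have := hB _ fx i; rewrite -(ler_pM2r w0) -{1}(gtr0_norm w0) -normrM [x _ _ * w]mulrC.
by rewrite !ler_norml => /andP[h3 h4]; apply/andP; split; lra.
Qed.

(** If [w x - k] lies in [cbox (delta * w - 2)], every [y] in the box satisfies
    [|w x - w y| <= delta * w - 1] coordinatewise, so uniform continuity gives [eps]; otherwise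
    [2 * Mf] is used. The last factor is at least 1 unless the mean and [f x] both vanish. *)
Lemma box_mean_dist (k : K) x :
  `|box_mean k - f x| <=
  (eps + 2 * Mf * \1_(~` cbox (delta * w - 2)) (w *: x - zvec R k)) *
  ((near_lattice B w k)%:R + \1_(cbox B) x).
Proof.
set E := eps + _.
have E0 : 0 <= E by rewrite addr_ge0// mulr_ge0// mulr_ge0.
have [h|/norP[kB xB]] := boolP (near_lattice B w k || (x \in cbox B)); last first.
  rewrite box_mean_eq0// indicE (negPf kB) (negPf xB) addr0 mulr0.
  rewrite sub0r normrN; have [->|fx] := eqVneq (f x) 0; first by rewrite normr0.
  by exfalso; move/negP: xB; apply; apply/mem_set; exact: hB.
apply: (@le_trans _ _ E); last first.
  rewrite ler_peMr// indicE -natrD ler1n.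
  by case/orP: h => ->; rewrite ?add1n ?addn1.
rewrite /E indicE in_setC; have [/set_mem hc|_] := boolP (_ \in cbox _).
  rewrite /= mulr0 addr0 ler_norml.
  suff /andP[? ?] : f x - eps <= box_mean k <= f x + eps.
    by apply/andP; split; lra.
  apply: box_mean_bounds => // y hy.
  suff : `|f x - f y| <= eps by rewrite ler_norml => /andP[? ?]; apply/andP; split; lra.
  apply: huc => i; have := hy i; rewrite in_box => /andP[h1 h2].
  rewrite -(ltr_pM2r w0) -{1}(gtr0_norm w0) -normrM mulrBl ![_ * w]mulrC.
  have := hc i; rewrite !mxE ler_norml ltr_norml => /andP[h3 h4].
  by rewrite [w * delta]mulrC; apply/andP; split; lra.
rewrite /= mulr1.
have : - Mf <= box_mean k <= Mf.
  by apply: box_mean_bounds => // y _; rewrite -ler_norml.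
rewrite -ler_norml => h1.
apply: (le_trans (ler_normB _ _)); have := hMf x; move: h1 eps0; lra.
Qed.

(** The partition of unity writes [f x] as the limit of the cube sums of [chi (w x - k) * f x]; the
    bound passes from the partial sums to the limit. *)
Lemma Kw_dist_le_maj (chi phi : 'rV[R]_n -> R) x :
  (forall k : K, `|chi (w *: x - zvec R k)| * `|box_mean k - f x| <=
    phi (w *: x - zvec R k) * ((near_lattice B w k)%:R + \1_(cbox B) x)) ->
  (forall u, 0 <= phi u) ->
  (fun N => cube_sum N (fun k => chi (w *: x - zvec R k))) @ \oo --> (1 : R) ->
  (`|Kw chi w f x - f x|%:E <= maj phi B w x)%E.
Proof.
move=> hk phi0 sum1.
pose u N := cube_sum N (fun k => chi (w *: x - zvec R k) * box_mean k).
have cu : u @ \oo --> Kw chi w f x.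
  pose N0 := Num.truncn (B * w + 1).
  (* Box means vanish outside a fixed cube, so the partial sums are eventually constant and the
     [lim] in [zsum] is a genuine limit. *)
  have uE : \forall N \near \oo, u N = u N0.
    exists N0 => // N /= NN0; rewrite /u !cube_sumE.
    rewrite (bigID (fun k => k \in cube N0))/= [X in _ + X]big1 ?addr0; last first.
      move=> k kN; rewrite box_mean_eq0 ?mulr0//.
      apply: contra kN => /set_mem kB; rewrite mem_cube; apply/forallP => i.
      have := kB i; rewrite mxE -intr_norm -[`|k i|]gez0_abs// -pmulrn => h.
      by rewrite lez_nat truncn_ge_nat// (le_trans _ h).
    rewrite -big_filter; apply: perm_big; apply: uniq_perm.
    - by rewrite filter_uniq ?cube_uniq.
    - exact: cube_uniq.
    move=> k; rewrite mem_filter; case kN: (k \in cube N0) => //=.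
    exact: cube_subset NN0 _ kN.
  have cu : u @ \oo --> u N0 by exact: cvg_near_cst.
  by rewrite (_ : Kw chi w f x = u N0)//; exact: cvg_lim cu.
pose v N := u N - f x * cube_sum N (fun k => chi (w *: x - zvec R k)).
have cv : v @ \oo --> Kw chi w f x - f x * 1.
  by apply: cvgB => //; apply: cvgM => //; exact: cvg_cst.
rewrite mulr1 in cv.
have cE : (fun N => (`|v N|)%:E) @ \oo --> (`|Kw chi w f x - f x|)%:E.
  by apply: cvg_EFin; [exact: nearW|exact: (cvg_norm cv)].
apply: (cvge_le _ cE).
apply: nearW => N; apply: le_trans (maj_sum_le_maj phi B w phi0 N x).
rewrite /maj_sum sumEFin lee_fin /v /u !cube_sumE mulr_sumr -sumrB.
apply: (le_trans (ler_norm_sum _ _ _)); apply: ler_sum => k _.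
apply: le_trans (hk k); rewrite -normrM mulrBr [f x * _]mulrC//.
Qed.

End sampling.

(** [Zw] is the sum of [Z (w x - k)] over all lattice points: countably many affine preimages of a
    null set form a null set. *)
Lemma iint_lattice_null (Z : 'rV[R]_n -> \bar R) (w : R) : 0 < w ->
  (forall y, (0 <= Z y)%E) -> measurable_fun setT (Z : V -> \bar R) ->
  iint n Z 0 = 0%E ->
  exists Zw : 'rV[R]_n -> \bar R,
  [/\ forall y, (0 <= Zw y)%E, measurable_fun setT (Zw : V -> \bar R),
      iint n Zw 0 = 0%E &
      forall x, Zw x = 0%E -> forall k : K, Z (w *: x - zvec R k) = 0%E].
Proof.
move=> w0 Z0 mZ IZ.
pose h N x := (\sum_(k <- cube N) Z (w *: x - zvec R k)%R)%E.
have mk (k : K) : measurable_fun setT ((fun x => Z (w *: x - zvec R k)) : V -> \bar R).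
  exact: (measurableT_comp mZ (measurable_affine w (zvec R k))).
have h0 N x : (0 <= h N x)%E by exact: sume_ge0.
have mh N : measurable_fun setT (h N : V -> \bar R) by exact: emeasurable_sum.
have ndh x : nondecreasing_seq (h^~ x).
  by move=> N N' NN'; apply: le_sum_uniq => //; [exact: cube_uniq|exact: cube_subset].
have hlim N x : (h N x <= limn (h^~ x))%E.
  apply: lime_ge; first exact: ereal_nondecreasing_is_cvgn.
  by exists N => // k; exact: ndh.
exists (fun x => limn (h^~ x)); split.
- by move=> x; exact: le_trans (hlim 0%N x).
- exact: measurable_lim.
- apply/eqP; rewrite eq_le iint_ge0 ?andbT; last first.
    by move=> x; exact: le_trans (hlim 0%N x).
  apply: iint_lim_le => // N; rewrite iint_sum// big1// => k _.
  by rewrite iint_affine// (iintn _ _ 0) IZ mule0.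
move=> x hx k; have [N sN] := seq_sub_cube [:: k].
apply/eqP; rewrite eq_le Z0 andbT -hx; apply: le_trans (hlim N x).
apply: (@le_trans _ _ (\sum_(k <- [:: k]) Z (w *: x - zvec R k)%R)%E).
  by rewrite big_seq1.
exact: le_sum_uniq.
Qed.

End convergence.

(** * Smallness of the mixed norm for large [w] *)

Section main.
Context {R : realType} {n : nat}.
Local Notation V := (borelV R n).
Local Notation K := {ffun 'I_n -> int}.

(** The power of the mixed norm appears because [iter_norm_le_iint] bounds this power linearly by
    the integral of the majorant. *)
Lemma mixed_norm_small (p : nat -> R) (alpha : R) (chi f : 'rV[R]_n -> R) (e : R) :
  (forall j, (j < n)%N -> 1 <= p j) ->
  (forall i j, (i <= j)%N -> (j < n)%N -> p i <= p j) ->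
  0 <= alpha -> is_kernel alpha chi -> continuous f ->
  compact (closure [set x | f x != 0]) -> 0 < e ->
  \forall w \near +oo,
    (mixed_norm p (fun x => Kw chi w f x - f x)%R `^ prev_exp p n <= e%:E)%E.
Proof.
move=> p1 pmono alpha0 kchi cf sf e0.
have [B B0 hB] := compact_supp_bounded f sf.
have [Mf Mf0 hMf] := compact_supp_fun_bounded f cf sf.
have [M M0 hM] := kernel_abs_sum_bounded alpha chi alpha0 kchi.
have [[mchi Ichi] _ sum1 _] := kchi.
have [Z [Z0 mZ IZ mpsi]] := borel_modification chi mchi.
pose psi y := if Z y == 0%E then `|chi y| else 0.
rewrite -/psi in mpsi.
have psi0 u : 0 <= psi u by rewrite /psi; case: ifP.
have psi_le u : psi u <= `|chi u| by rewrite /psi; case: ifP.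
pose S := iint n (fun u => (psi u)%:E) 0.
have S_fin : (S < +oo)%E.
  apply: le_lt_trans Ichi; rewrite iter_norm1E; last by move=> y; rewrite lee_fin.
  by apply: le_iint => y; rewrite lee_fin.
have S0 : (0 <= S)%E by apply: iint_ge0 => y; rewrite lee_fin.
have SE : S = (fine S)%:E by rewrite fineK// ge0_fin_numE.
have s0 : 0 <= fine S by exact: fine_ge0.
pose A := (2 * B + 3) ^+ n.
have A0 : 0 <= A by rewrite exprn_ge0// addr_ge0// mulr_ge0// ltW.
(* Bounds the lattice sums of [phi] below, since [c <= 1]. It is independent of [w] and [c], so [D]
   can be fixed before both. *)
pose M' := (1 + 2 * Mf) * M.
have [D D0 hD] := iter_norm_le_iint p (2 * M' * A) p1 pmono n (leqnn n).
(* [c] is chosen so that [D * 2A * (eps * S + 2 Mf * tau) <= e] for [eps, tau <= c]. *)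
pose c := Num.min 1 (e / (D * (2 * A) * (fine S + 2 * Mf) + 1)).
have T0 : 0 <= D * (2 * A) * (fine S + 2 * Mf).
  by rewrite mulr_ge0 ?mulr_ge0 ?addr_ge0 ?mulr_ge0.
have c0 : 0 < c by rewrite /c lt_min ltr01 divr_gt0// ltr_wpDl.
have c1 : c <= 1 by rewrite /c ge_min lexx.
have [delta delta0 huc] := compact_supp_unif f cf sf c c0.
have [r0 hr0] := iint_tail psi c psi0 mpsi S_fin c0.
near=> w.
have w1 : 1 <= w by near: w; apply: nbhs_pinfty_ge; rewrite num_real.
have w0 : 0 < w by exact: lt_le_trans w1.
have rw : r0 <= delta * w - 2.
  by rewrite lerBrDr mulrC -ler_pdivrMr.
pose tail (u : 'rV[R]_n) : R := \1_(~` cbox (delta * w - 2)) u.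
(* The second factor is the bound of [box_mean_dist] with [eps := c]. *)
pose phi u := psi u * (c + 2 * Mf * tail u).
have fac0 u : 0 <= c + 2 * Mf * tail u.
  by rewrite addr_ge0 ?(ltW c0)// mulr_ge0// mulr_ge0.
have phi0 u : 0 <= phi u by rewrite mulr_ge0.
have mtail : measurable_fun setT (tail : V -> R).
  by apply: measurable_indic; apply: measurableC; exact: measurable_cbox.
have mphi : measurable_fun setT (phi : V -> R).
  apply: measurable_funM => //; apply: measurable_funD => //.
  exact: measurable_funM.
have phiM u N : \sum_(k <- cube N) phi (u - zvec R k) <= M'.
  apply: (@le_trans _ _ (\sum_(k <- cube N) (1 + 2 * Mf) * `|chi (u - zvec R k)|)).
    apply: ler_sum => k _; rewrite mulrC; apply: ler_pM => //.
    rewrite lerD// -[leRHS]mulr1 ler_wpM2l ?mulr_ge0// /tail indicE.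
    by rewrite lern1 leq_b1.
  by rewrite -mulr_sumr ler_wpM2l// addr_ge0// mulr_ge0.
have [Zw [Zw0 mZw IZw hZw]] := iint_lattice_null Z w w0 Z0 mZ IZ.
have Iphi : (iint n (fun u => (phi u)%:E) 0 <= (c * (fine S + 2 * Mf))%:E)%E.
  pose t u : \bar R := (psi u * tail u)%:E.
  have t0 u : (0 <= t u)%E by rewrite lee_fin mulr_ge0.
  have mt : measurable_fun setT (t : V -> \bar R).
    by apply/measurable_EFinP; exact: measurable_funM.
  have mPsi : measurable_fun setT ((fun u => (psi u)%:E) : V -> \bar R).
    exact/measurable_EFinP.
  rewrite (eq_iint _ _ (fun u => c%:E * (psi u)%:E + (2 * Mf)%:E * t u)%E); last first.
    by move=> u; rewrite /t -!EFinM -EFinD /phi; congr EFin; ring.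
  have Psi0 u : (0 <= (psi u)%:E)%E by rewrite lee_fin.
  have Mf20 : 0 <= 2 * Mf by rewrite mulr_ge0.
  rewrite iintD//; last 4 first.
  - by move=> u; rewrite mule_ge0// lee_fin ltW.
  - by move=> u; rewrite mule_ge0// lee_fin.
  - exact: emeasurable_funM.
  - exact: emeasurable_funM.
  rewrite !iintZ ?(ltW c0)// -/S SE mulrDr EFinD EFinM; apply: leeD => //.
  rewrite [c * _]mulrC EFinM; apply: lee_wpmul2l; first by rewrite lee_fin.
  exact: hr0.
have H := hD (fun x => `|Kw chi w f x - f x|%:E) (maj phi B w) Zw.
apply: (le_trans (H _ _ _ _ _ _ _ 0 IZw)) => //.
- exact: maj_ge0.
- exact: measurable_maj.
- by move=> i y /ltnW; apply: (iint_maj_marginal phi M') => //; exact: ltW.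
- move=> x Zx; apply: Kw_dist_le_maj => //.
  (* Where [Zw] vanishes, [Z] vanishes at every [w x - k], so [psi] agrees with [|chi|] at all the
     sample points. *)
  move=> k; rewrite /phi /psi hZw// eqxx -[leRHS]mulrA ler_wpM2l//.
  by apply: box_mean_dist => //; exact: ltW.
apply: (@le_trans _ _ (D%:E * ((2 * A)%:E * (c * (fine S + 2 * Mf))%:E))%E).
  apply: lee_wpmul2l; first by rewrite lee_fin.
  apply: (le_trans (iint_maj_total phi B w phi0 mphi (ltW B0) w1 0)).
  by apply: lee_wpmul2l => //; rewrite lee_fin mulr_ge0.
rewrite -!EFinM lee_fin.
apply: (@le_trans _ _ (D * (2 * A) * (fine S + 2 * Mf) * c)).
  by rewrite le_eqVlt; apply/orP; left; apply/eqP; ring.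
apply: (@le_trans _ _ (D * (2 * A) * (fine S + 2 * Mf) *
    (e / (D * (2 * A) * (fine S + 2 * Mf) + 1)))).
  by rewrite ler_wpM2l// /c ge_min lexx orbT.
rewrite mulrA ler_pdivrMr ?ltr_wpDl// mulrC ler_pM2l// lerDl ler01//.
Unshelve. all: by end_near. Qed.

End main.

Theorem theorem4p3 (R : realType) (n : nat) (p : nat -> R) (alpha : R)
  (chi : 'rV[R]_n -> R) (f : 'rV[R]_n -> R) :
  (forall j, (j < n)%N -> 1 <= p j) ->
  (forall i j, (i <= j)%N -> (j < n)%N -> p i <= p j) ->
  0 <= alpha ->
  is_kernel alpha chi ->
  continuous f ->
  compact (closure [set x | f x != 0]) ->
  mixed_norm p (fun x => Kw chi w f x - f x) @[w --> +oo%R]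
    --> 0%E.
Proof.
move=> p1 pmono alpha0 kchi cf sf.
set G := fun w => mixed_norm p _.
have G0 w : (0 <= G w)%E by apply: iter_norm_ge0 => x; rewrite lee_fin.
have q0 : 0 < prev_exp p n.
  by case: n p1 {pmono chi f kchi cf sf G G0} => //= m p1; rewrite (lt_le_trans ltr01)// p1.
have small (e : R) : 0 < e -> \forall w \near +oo, (G w <= e%:E)%E.
  move=> e0.
  (* The tolerance is raised to the same power as the norm; taking the root then gives
     [G w <= e]. *)
  have := mixed_norm_small p alpha chi f (e `^ prev_exp p n) p1 pmono alpha0 kchi cf sf.
  rewrite powR_gt0// => /(_ isT); apply: filterS => w hw.
  have E x : (0 <= x)%E -> x = ((x `^ prev_exp p n) `^ (prev_exp p n)^-1)%E.
    by move=> x0; rewrite -poweRrM mulfV ?gt_eqF// poweRe1.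
  have e0' : (0 <= e%:E)%E by rewrite lee_fin ltW.
  rewrite (E _ (G0 w)) (E _ e0').
  apply: (@gt0_ler_poweR R (prev_exp p n)^-1) => //.
  - by rewrite invr_ge0 ltW.
  - by rewrite in_itv/= leey poweR_ge0.
  - by rewrite in_itv/= leey lee_fin powR_ge0.
(* Convergence in the extended reals splits into eventual finiteness, from the tolerance 1, and
   convergence of the real values. *)
apply/fine_cvgP; split.
  apply: filterS (small 1 ltr01) => w hw.
  by rewrite ge0_fin_numE//; exact: le_lt_trans hw (ltry _).
apply/cvgrPdist_le => e e0; apply: filterS (small e e0) => w hw.
rewrite sub0r normrN ger0_norm ?fine_ge0//.
by rewrite -lee_fin fineK// ge0_fin_numE//; exact: le_lt_trans hw (ltry _).
Qed.
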